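(* For $0\le k\le (n-1)/2$ we have \[ \gamma_{n,k}(q):=\sum_{\sigma\in \mathrm{DD}_{n,k}}q^{2(31\text{-}2)\sigma+(2\text{-}13)\sigma} =\sum_{\sigma\in \mathrm{DE}^*_{n,k}}q^{\mathsf{inv}\,\sigma-\mathsf{exc}\,\sigma} =\sum_{\sigma\in \mathrm{SDE}_{n,k}}q^{\mathsf{inv}\,\sigma-\mathsf{exc}\,\sigma}. \]
   Context: For $\sigma\in\mathfrak{S}_n$: $\mathsf{des}\,\sigma$ is the number of $i\in[n-1]$ with $\sigma(i)>\sigma(i+1)$; $\mathsf{exc}\,\sigma$ is the number of $i$ with $\sigma(i)>i$; $\mathsf{inv}\,\sigma$ is the number of inversions; with convention $\sigma(0)=\sigma(n+1)=0$, $\mathsf{dd}\,\sigma$ is the number of double descents, i.e. values $\sigma(i)$ ($1\le i\le n$) with $\sigma(i-1)>\sigma(i)>\sigma(i+1)$. The vincular pattern statistics are $(31\text{-}2)\sigma=\#\{(i,j): i+1<j\le n,\ \sigma(i+1)<\sigma(j)<\sigma(i)\}$ and $(2\text{-}13)\sigma=\#\{(i,j): j<i<n,\ \sigma(i)<\sigma(j)<\sigma(i+1)\}$. The star companion of $\sigma\in\mathfrak{S}_n$ is the permutation $\sigma^*$ of $\{0,1,\ldots,n\}$ with $\sigma^*(0)=n$ and $\sigma^*(i)=\sigma(i)-1$ for $i\in[n]$. Let $\mathsf{cda}^*\sigma=\#\{i\in[n-1]: (\sigma^* )^{-1}(i)<i<\sigma^*(i)\}$ and $\mathsf{fix}^*\sigma=\#\{i\in[n-1]: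 \sigma^*(i)=i\}$. Let $\mathsf{scda}\,\sigma=\#\{i\in[n-1]: i<\sigma(i)\ \text{and}\ i+1>\sigma^{-1}(i+1)\}$. Define $\mathrm{DD}_{n,k}=\{\sigma\in\mathfrak{S}_n:\mathsf{des}\,\sigma=k,\ \mathsf{dd}\,\sigma=0\}$, $\mathrm{DE}^*_{n,k}=\{\sigma\in\mathfrak{S}_n:\mathsf{exc}\,\sigma=k,\ \mathsf{cda}^*\sigma+\mathsf{fix}^*\sigma=0\}$, and $\mathrm{SDE}_{n,k}=\{\sigma\in\mathfrak{S}_n:\mathsf{exc}\,\sigma=k,\ \mathsf{scda}\,\sigma=0\}$. *)

(* Defs.v *)
From HB Require Import structures.
From mathcomp Require Import all_boot all_order all_algebra all_fingroup.
Set Implicit Arguments. Unset Strict Implicit. Unset Printing Implicit Defensive.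
Import GRing.Theory.

(* A permutation of [n] = {1,...,n} is represented by s : 'S_n (a permutation
   of {0,...,n-1}); sig s i is sigma(i) = s(i-1)+1 for 1 <= i <= n, and
   sig s i = 0 otherwise (in particular sigma(0) = sigma(n+1) = 0). *)
Definition sig n (s : 'S_n) (i : nat) : nat :=
  if 0 < i then oapp (fun j : 'I_n => (s j).+1) 0 (insub i.-1) else 0.

Definition siginv n (s : 'S_n) (i : nat) : nat := sig s^-1 i.

Definition des n (s : 'S_n) : nat :=
  count (fun i => sig s i > sig s i.+1) (iota 1 n.-1).

Definition exc n (s : 'S_n) : nat :=
  count (fun i => sig s i > i) (iota 1 n).

Definition inv n (s : 'S_n) : nat :=
  \sum_(1 <= i < n.+1) \sum_(i.+1 <= j < n.+1) (sig s i > sig s j).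

Definition dd n (s : 'S_n) : nat :=
  count (fun i => (sig s i.-1 > sig s i) && (sig s i > sig s i.+1)) (iota 1 n).

Definition pat31_2 n (s : 'S_n) : nat :=
  \sum_(1 <= i < n.+1) \sum_(i.+2 <= j < n.+1)
     ((sig s i.+1 < sig s j) && (sig s j < sig s i)).

Definition pat2_13 n (s : 'S_n) : nat :=
  \sum_(1 <= i < n) \sum_(1 <= j < i)
     ((sig s i < sig s j) && (sig s j < sig s i.+1)).

Definition star n (s : 'S_n) (i : nat) : nat :=
  if i == 0 then n else (sig s i).-1.

Definition starinv n (s : 'S_n) (i : nat) : nat :=
  nth 0 (iota 0 n.+1) (find (fun p => star s p == i) (iota 0 n.+1)).

Definition cdastar n (s : 'S_n) : nat :=
  count (fun i => (starinv s i < i) && (i < star s i)) (iota 1 n.-1).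

Definition fixstar n (s : 'S_n) : nat :=
  count (fun i => star s i == i) (iota 1 n.-1).

Definition scda n (s : 'S_n) : nat :=
  count (fun i => (i < sig s i) && (siginv s i.+1 < i.+1)) (iota 1 n.-1).

Local Open Scope ring_scope.

Definition gammaDD n k : {poly int} :=
  \sum_(s : 'S_n | (des s == k) && (dd s == 0)%N) 'X^(2 * pat31_2 s + pat2_13 s).

Definition gammaDEstar n k : {poly int} :=
  \sum_(s : 'S_n | (exc s == k) && (cdastar s + fixstar s == 0)%N)
     'X^(inv s - exc s).

Definition gammaSDE n k : {poly int} :=
  \sum_(s : 'S_n | (exc s == k) && (scda s == 0)%N) 'X^(inv s - exc s).

(* Main.v *)
Require Import Defs.
From mathcomp Require Import all_boot all_order all_algebra all_fingroup.
From mathcomp Require Import zify ring.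
Set Implicit Arguments. Unset Strict Implicit. Unset Printing Implicit Defensive.
Import GRing.Theory.

(** The sets [DE*] and [SDE] coincide, because [starinv s i = siginv s i.+1].
  For the other equality we refine both sides by one more variable:
  the sums of [q^(2 (31-2) + (2-13)) x^des t^dd] and of [q^(inv - exc) x^exc t^scda]
  over [S_n] agree, and [t = 0] selects [DD] and [SDE].  Both sums are generating
  functions of weighted Motzkin paths.  Inserting the values 1, 2, ... into a word with
  [h] holes, at a hole with [j] holes to its left, contributes
  [q^(2 j + (h - 1 - j))]; hence the step weight [q^(h-1) [h]_q] in each of the cases
  valley, double ascent, double descent, peak.  For excedances, position [i] is
  processed together with the value [i + 1]; with [h] values still to be placed the up
  step weighs [x q^(2 h - 1)], the level step [(1 + x t) q^(h-1) [h]_q] and the down step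
  [[h]_q [h-1]_q].  The products of matching up and down steps agree.
  That the words generated are exactly the permutations follows from every permutation
  being generated together with the value [n!] of the path count at [q = x = t = 1]. *)

(** * Weighted Motzkin paths *)

Section PolynomialRecursions.
Local Open Scope ring_scope.
Variables (R : comNzRingType) (q x t : R).

Definition qint (h : nat) : R := \sum_(j < h) q ^+ j.

(* [k] steps from height [h]; at [h = 0] the truncated [h.-1] is harmless as [qint 0 = 0]. *)
Fixpoint ddpoly (k h : nat) : R :=
  if k is k'.+1 then
    q ^+ h.-1 * qint h *
      (x * ddpoly k' h.+1 + (1 + x * t) * ddpoly k' h + ddpoly k' h.-1)
  else (h == 0%N)%:R.

Fixpoint excpoly (k h : nat) : R :=
  if k is k'.+1 then
    x * q ^+ (2 * h).-1 * excpoly k' h.+1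
      + (1 + x * t) * (q ^+ h.-1 * qint h) * excpoly k' h
      + qint h * qint h.-1 * excpoly k' h.-1
  else (h == 1%N)%:R.

Lemma qint0 : qint 0 = 0. Proof. by rewrite /qint big_ord0. Qed.

Lemma qint1 : qint 1 = 1. Proof. by rewrite /qint big_ord1 expr0. Qed.

Lemma ddpolyS0 k : ddpoly k.+1 0 = 0.
Proof. by rewrite /= qint0 mulr0 mul0r. Qed.

(* Both recursions count weighted Motzkin paths, and they agree on the product of
   an up step and the matching down step; the factor below is the discrepancy
   accumulated by the unmatched up steps. *)
Lemma excpoly_ddpoly k h :
  q ^+ 'C(h.+1, 2) * excpoly k h.+1 = (\prod_(1 <= j < h.+1) qint j) * ddpoly k.+1 h.+1.
Proof.
elim: k h => [|k IHk] h.
  rewrite /= eqSS; case: h => [|h] /=.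
    by rewrite bin_small // qint1 big_nil expr0 mulr0n mulr1n; ring.
  by rewrite mulr0n; ring.
have IH2 := IHk h.+1; have IH1 := IHk h.
rewrite [excpoly _ _]/= -[ddpoly k.+2 _]/(_ * _ *
  (x * ddpoly k.+1 h.+2 + (1 + x * t) * ddpoly k.+1 h.+1 + ddpoly k.+1 h)).
rewrite !mulrDr.
(* At height 0 both sides vanish because [qint 0 = 0]; above it [IHk] applies at the lower
   height. *)
have down j : q ^+ 'C(j.+1, 2) * (qint j.+1 * qint j * excpoly k j) =
    (\prod_(1 <= i < j.+1) qint i) * (q ^+ j * qint j.+1 * ddpoly k.+1 j).
  case: j => [|j]; first by rewrite ddpolyS0 qint0 !(mulr0, mul0r).
  transitivity (q ^+ j.+1 * qint j.+2 * qint j.+1 * (q ^+ 'C(j.+1, 2) * excpoly k j.+1)).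
    by rewrite [in LHS]binS bin1 exprD; ring.
  by rewrite IHk [in RHS]big_nat_recr //=; ring.
set P := \prod_(1 <= j < h.+1) _ in IH1 *.
have EP : \prod_(1 <= j < h.+2) qint j = P * qint h.+1 by rewrite big_nat_recr.
have up : q ^+ 'C(h.+1, 2) * (x * q ^+ (2 * h.+1).-1 * excpoly k h.+2) =
    P * (q ^+ h * qint h.+1 * (x * ddpoly k.+1 h.+2)).
  (* The exponents agree because ['C(h.+1, 2) + (2 * h + 1) = h + 'C(h.+2, 2)]. *)
  transitivity (x * q ^+ h * (q ^+ 'C(h.+2, 2) * excpoly k h.+2)).
    rewrite [in RHS]binS bin1 exprD (_ : (2 * h.+1).-1 = h + h.+1)%N ?exprD; last by lia.
    by ring.
  by rewrite IH2 EP; ring.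
have flat : q ^+ 'C(h.+1, 2) * ((1 + x * t) * (q ^+ h * qint h.+1) * excpoly k h.+1) =
    P * (q ^+ h * qint h.+1 * ((1 + x * t) * ddpoly k.+1 h.+1)).
  transitivity ((1 + x * t) * (q ^+ h * qint h.+1) * (q ^+ 'C(h.+1, 2) * excpoly k h.+1)).
    by ring.
  by rewrite IH1; ring.
by rewrite up flat down.
Qed.

Lemma excpoly1 k : excpoly k 1 = ddpoly k.+1 1.
Proof. by have := excpoly_ddpoly k 0; rewrite bin_small // big_nil expr0 !mul1r. Qed.

End PolynomialRecursions.

Section Count.
Local Open Scope ring_scope.
Variable R : comNzRingType.

(** This will count generated words, [h = 0] giving a factorial. By Pascal's rule the neighbouring
    terms add up to ['C(k.+2, h.+1)], and the factor [h.+1] turns this into [k.+2 * 'C(k.+1, h)]. *)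
Lemma ddpoly_unweighted k h :
  ddpoly (1 : R) 1 1 k.+1 h.+1 = (k.+1`! * 'C(k, h))%N%:R.
Proof.
have qintE j : qint (1 : R) j = j%:R.
  by rewrite /qint (eq_bigr (fun=> 1)) ?sumr_const ?card_ord // => i _; rewrite expr1n.
elim: k h => [|k IHk] h.
  case: h => [|h] /=; first by rewrite qint1 /= mulr0n mulr1n; ring.
  by rewrite bin_small // muln0 !mulr0n; ring.
rewrite -[LHS]/(1 ^+ h * qint 1 h.+1 * (1 * ddpoly 1 1 1 k.+1 h.+2 + (1 + 1 * 1) *
  ddpoly 1 1 1 k.+1 h.+1 + ddpoly 1 1 1 k.+1 h)).
(* At [h = 0] this term must be 0, whereas truncated subtraction would give ['C(k, 0) = 1]. *)
have -> : ddpoly (1 : R) 1 1 k.+1 h =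
    (k.+1`! * (if h is h'.+1 then 'C(k, h') else 0))%N%:R.
  by case: h => [|h]; rewrite ?IHk // ddpolyS0 muln0.
rewrite qintE expr1n !IHk !mul1r -[1 + 1]/(2%:R) -!natrM -!natrD -!natrM.
congr (_%:R); have : (k.+2 * 'C(k.+1, h) = h.+1 * 'C(k.+2, h.+1))%N.
  exact: mul_bin_diag.
have -> : 'C(k.+2, h.+1) =
    ('C(k, h.+1) + 2 * 'C(k, h) + (if h is h'.+1 then 'C(k, h') else 0))%N.
  by case: h => [|h]; rewrite ?binS ?bin0 ?bin1; lia.
have -> : (k.+2)`! = (k.+2 * k.+1`!)%N by exact: factS.
move: 'C(k, h.+1) 'C(k, h) (if h is _.+1 then _ else _)%N 'C(k.+1, h) => a b c d E.
by rewrite mulnAC E; ring.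
Qed.

End Count.

(** * Permutations as words *)

Definition word n (s : 'S_n) : seq nat := [seq sig s i | i <- iota 1 n].

Lemma sig_gt n (s : 'S_n) i : n < i -> sig s i = 0.
Proof. by case: i => // i le_n_i; rewrite /sig /= insubF //=; lia. Qed.

Lemma sig_ord n (s : 'S_n) (i : 'I_n) : sig s i.+1 = (s i).+1.
Proof. by rewrite /sig /= valK. Qed.

Lemma size_word n (s : 'S_n) : size (word s) = n.
Proof. by rewrite size_map size_iota. Qed.

Lemma nth_word n (s : 'S_n) p : nth 0 (word s) p = sig s p.+1.
Proof.
have [lt_pn|le_np] := ltnP p n; last by rewrite nth_default ?size_word // sig_gt.
by rewrite (nth_map 0) ?size_iota // nth_iota.
Qed.

Lemma word_enum n (s : 'S_n) : word s = [seq (s i).+1 | i <- enum 'I_n].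
Proof.
rewrite /word -[1]addn0 iotaDl -map_comp -val_enum_ord -map_comp.
by apply: eq_map => i /=; rewrite add1n sig_ord.
Qed.

Lemma word_inj n : injective (@word n).
Proof.
move=> s1 s2 E; apply/permP => i; apply/val_inj.
by have := congr1 (nth 0 ^~ i) E; rewrite !nth_word !sig_ord => -[].
Qed.

Lemma uniq_word n (s : 'S_n) : uniq (word s).
Proof. by rewrite word_enum map_inj_uniq ?enum_uniq // => i j [/val_inj/perm_inj]. Qed.

Lemma mem_word n (s : 'S_n) i : (i \in word s) = (0 < i <= n).
Proof.
rewrite word_enum; apply/mapP/idP => [[j _ ->]|]; first by rewrite ltn_ord.
case: i => // i lt_in; exists (s^-1 (Ordinal lt_in))%g; first by rewrite mem_enum.
by rewrite permKV.
Qed.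

(** Pigeonhole: a list of length n! that contains the n! distinct words is a rearrangement of them.
    So membership and a count show that a generator is exact. *)
Lemma sum_word (V : nmodType) n (L : seq (seq nat)) (f : seq nat -> V) :
    size L = n`! -> (forall s : 'S_n, word s \in L) ->
  (\sum_(s : 'S_n) f (word s) = \sum_(w <- L) f w)%R.
Proof.
move=> sizeL wordL; rewrite -(big_map (@word n) xpredT f).
have uniqW : uniq [seq word s | s <- index_enum 'S_n].
  by rewrite map_inj_uniq ?index_enum_uniq //; apply: word_inj.
have sizeW : size [seq word s | s <- index_enum 'S_n] = n`!.
  by rewrite size_map -card_Sn cardT enumT.
have subW : {subset [seq word s | s <- index_enum 'S_n] <= L}.
  by move=> w /mapP[s _ ->]; apply: wordL.
have [//|_ eqW] := uniq_min_size uniqW subW; first by rewrite sizeL sizeW.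
apply: perm_big; apply: uniq_perm => //.
by rewrite -(eq_uniq _ eqW) // sizeL sizeW.
Qed.

Section Leaves.
Variables (children : nat -> seq nat -> seq (seq nat)) (final : seq nat -> seq (seq nat)).

Fixpoint leaves k m (c : seq nat) : seq (seq nat) :=
  if k is k'.+1 then flatten [seq leaves k' m.+1 d | d <- children m c] else final c.

(** Here [r i] is the state at stage [i] of the branch that ends in [w]. *)
Lemma mem_leaves (r : nat -> seq nat) w k m :
    (forall i, m <= i < m + k -> r i.+1 \in children i (r i)) ->
  w \in final (r (m + k)) -> w \in leaves k m (r m).
Proof.
elim: k m => [|k IHk] m step w_r; first by rewrite addn0 in w_r.
apply/flatten_mapP; exists (r m.+1); first by apply: step; lia.
by apply: IHk => [i le_i|]; [apply: step; lia | rewrite addSnnS].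
Qed.

End Leaves.

Fixpoint splits (a : nat) (c : seq nat) : seq (seq nat * seq nat) :=
  if c is b :: c' then
    (if b == a then [:: ([::], c')] else [::])
      ++ [seq (b :: lr.1, lr.2) | lr <- splits a c']
  else [::].

Lemma mem_splits a c l r : ((l, r) \in splits a c) = (c == l ++ a :: r).
Proof.
elim: c l => [|b c IHc] l /=; first by case: l.
rewrite mem_cat; case: l => [|b' l] /=.
  rewrite [X in _ || X](_ : _ = false) ?orbF; last by apply/mapP => -[[]].
  rewrite eqseq_cons eq_sym; case: eqVneq => //= _.
  by rewrite inE xpair_eqE eqxx eq_sym.
rewrite [X in X || _](_ : _ = false) /=; last by case: ifP; rewrite // inE xpair_eqE.
rewrite eqseq_cons -IHc; apply/mapP/andP => [[[l1 r1] + [-> -> ->]]|[/eqP-> lr_c]] //.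
by exists (l, r).
Qed.

Section SumSplits.
Local Open Scope ring_scope.
Variables (R : comNzRingType) (q : R).

(** The successive occurrences of [a] have 0, 1, 2, ... occurrences to their left. This is how the
    choice of a hole produces a q-integer. *)
Lemma sum_splits a c :
  \sum_(lr <- splits a c) q ^+ count_mem a lr.1 = qint q (count_mem a c).
Proof.
elim: c => [|b c IHc]; first by rewrite big_nil qint0.
have E : \sum_(lr <- splits a c) q ^+ count_mem a (b :: lr.1) =
    q ^+ (b == a) * qint q (count_mem a c).
  by rewrite -IHc big_distrr; apply: eq_bigr => lr _; rewrite /= exprD.
rewrite [splits _ _]/= big_cat big_map E (_ : count_mem a (b :: c) = (b == a) + count_mem a c)%N //.
case: eqVneq => _; last by rewrite big_nil expr0 mul1r /= add0r.
rewrite big_seq1 /qint add1n big_ord_recl /= !expr0; congr (_ + _).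
by rewrite expr1 big_distrr; apply: eq_bigr => i _; rewrite /= -exprS.
Qed.

Lemma sum_index (s : seq nat) :
  uniq s -> \sum_(u <- s) q ^+ index u s = qint q (size s).
Proof.
move=> uniq_s; rewrite (big_nth 0%N) big_mkord.
by apply: eq_bigr => i _; rewrite index_uniq.
Qed.

End SumSplits.

(** * Descents and vincular patterns *)

Fixpoint adjsum (f : nat -> nat -> nat) (a : nat) (w : seq nat) : nat :=
  if w is b :: w' then f a b + adjsum f b w' else 0.

Lemma adjsum_cat f a v w : adjsum f a (v ++ w) = adjsum f a v + adjsum f (last a v) w.
Proof. by elim: v a => //= b v IHv a; rewrite IHv addnA. Qed.

(** With [c] in the role of the 2, these count the adjacent pairs 31 and 13 of the two vincular
    patterns; [a] is the letter preceding [w]. *)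
Definition descents_over c a w := adjsum (fun a b => b < c < a) a w.
Definition ascents_over c a w := adjsum (fun a b => a < c < b) a w.

Lemma descents_over_above c a b w :
  c < a -> c < b -> descents_over c a w = descents_over c b w.
Proof. by case: w => //= d w; rewrite /descents_over /= => -> ->. Qed.

Lemma ascents_over_above c a b w :
  c <= a -> c <= b -> ascents_over c a w = ascents_over c b w.
Proof. by case: w => //= d w; rewrite /ascents_over /= !ltnNge => -> ->. Qed.

(** A block of letters above [c] acts like one large letter: no pair inside it straddles [c], and
    what follows only sees that its last letter exceeds [c], so [c.+1] can stand in for that
    letter. *)
Lemma descents_over_cat c a l v r : v != [::] -> all (ltn c) v ->
  descents_over c a (l ++ v ++ r) = descents_over c a l + descents_over c c.+1 r.
Proof.
move=> v0 gt_v; rewrite /descents_over !adjsum_cat; congr (_ + _).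
rewrite (_ : adjsum _ (last a l) v = 0).
  apply: descents_over_above => //; case/lastP: v v0 gt_v => // v b _.
  by rewrite all_rcons last_rcons => /andP[].
by elim: v (last a l) gt_v {v0} => //= b v IHv a' /andP[lt_cb /IHv->]; lia.
Qed.

(** Here [c] itself can stand in for the end of the block, as an ascent over [c] starts strictly
    below [c]. *)
Lemma ascents_over_cat c a l v r : v != [::] -> all (ltn c) v ->
  ascents_over c a (l ++ v ++ r)
    = ascents_over c a l + (last a l < c) + ascents_over c c r.
Proof.
move=> v0 gt_v; rewrite /ascents_over !adjsum_cat addnA; congr (_ + _ + _).
  case: v v0 gt_v => //= b v _ /andP[lt_cb gt_v]; rewrite lt_cb andbT.
  suff -> : adjsum (fun a b => a < c < b) b v = 0 by rewrite addn0.
  by elim: v b lt_cb gt_v => //= d v IHv b lt_cb /andP[lt_cd /IHv->] //; lia.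
apply: ascents_over_above => //; case/lastP: v v0 gt_v => // v b _.
by rewrite all_rcons last_rcons => /andP[/ltnW].
Qed.

Section Weight.
Local Open Scope ring_scope.
Variables (N : nat) (R : comNzRingType) (q x t : R).

(* The contribution of a value [c] between the factors [l] and [r] of a word.  In a word
   with holes the letter [N], larger than every value, stands for a hole; the missing
   neighbours at both ends read as 0, as in [sig]. *)
Definition letter_weight (l : seq nat) c (r : seq nat) : R :=
  q ^+ (2 * descents_over c 0 l + ascents_over c c r)
    * x ^+ (c < last 0 l)%N * t ^+ ((c < last 0 l) && (head 0 r < c))%N.

(** This is why holes retain enough information: a value sees a block of larger letters only as one
    large letter, so later insertions leave its weight unchanged. *)
Lemma letter_weight_left l v v' r c s :
    v != [::] -> all (ltn c) v -> v' != [::] -> all (ltn c) v' ->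
  letter_weight (l ++ v ++ r) c s = letter_weight (l ++ v' ++ r) c s.
Proof.
move=> v0 gt_v v'0 gt_v'; rewrite /letter_weight.
rewrite !(@descents_over_cat c 0 l _ r) //.
suff -> : (c < last 0 (l ++ v ++ r))%N = (c < last 0 (l ++ v' ++ r))%N by [].
rewrite !last_cat; case: r => //.
have lt_last u a : u != [::] -> all (ltn c) u -> (c < last a u)%N.
  by case/lastP: u => // u b _; rewrite all_rcons last_rcons => /andP[].
by rewrite /= !lt_last.
Qed.

Lemma letter_weight_right l v v' r c s :
    v != [::] -> all (ltn c) v -> v' != [::] -> all (ltn c) v' ->
  letter_weight s c (l ++ v ++ r) = letter_weight s c (l ++ v' ++ r).
Proof.
move=> v0 gt_v v'0 gt_v'; rewrite /letter_weight.
rewrite !(@ascents_over_cat c c l _ r) //.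
suff -> : (head 0 (l ++ v ++ r) < c)%N = (head 0 (l ++ v' ++ r) < c)%N by [].
case: l => //=; case: v v0 gt_v => // b v _ /andP[lt_cb _].
case: v' v'0 gt_v' => // b' v' _ /andP[lt_cb' _] /=.
by rewrite /= in lt_cb lt_cb' *; lia.
Qed.

Fixpoint weight_within (l w r : seq nat) : R :=
  if w is c :: w' then
    (if c == N then 1 else letter_weight l c (w' ++ r)) * weight_within (l ++ [:: c]) w' r
  else 1.

Definition dd_weight w := weight_within [::] w [::].

Lemma weight_within_cat l v w r :
  weight_within l (v ++ w) r = weight_within l v (w ++ r) * weight_within (l ++ v) w r.
Proof.
elim: v l => [|c v IHv] l /=; first by rewrite cats0 mul1r.
by rewrite IHv catA -catA mulrA /= -catA.
Qed.

Lemma weight_within_left l v v' r w s m :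
    v != [::] -> all (ltn m) v -> v' != [::] -> all (ltn m) v' ->
    all (fun c => (c <= m)%N || (c == N)) w ->
  weight_within (l ++ v ++ r) w s = weight_within (l ++ v' ++ r) w s.
Proof.
move=> v0 gt_v v'0 gt_v'; elim: w r => //= c w IHw r /andP[le_c le_w].
rewrite -!catA IHw //; congr (_ * _); case: ifP => // c_N.
rewrite c_N orbF in le_c; apply: letter_weight_left => //.
  by apply: sub_all gt_v => b /=; lia.
by apply: sub_all gt_v' => b /=; lia.
Qed.

Lemma weight_within_right l v v' r w s m :
    v != [::] -> all (ltn m) v -> v' != [::] -> all (ltn m) v' ->
    all (fun c => (c <= m)%N || (c == N)) w ->
  weight_within s w (l ++ v ++ r) = weight_within s w (l ++ v' ++ r).
Proof.
move=> v0 gt_v v'0 gt_v'; elim: w s => //= c w IHw s /andP[le_c le_w].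
rewrite IHw //; congr (_ * _); case: ifP => // c_N.
rewrite c_N orbF in le_c; rewrite !(catA w); apply: letter_weight_right => //.
  by apply: sub_all gt_v => b /=; lia.
by apply: sub_all gt_v' => b /=; lia.
Qed.

(** The values outside the hole are at most [m] and cannot distinguish [v] from a hole, so only the
    letters of [v] contribute a new factor. *)
Lemma dd_weight_fill l v r m :
    (m < N)%N -> v != [::] -> all (ltn m) v ->
    all (fun c => (c <= m)%N || (c == N)) (l ++ N :: r) ->
  dd_weight (l ++ v ++ r) = dd_weight (l ++ N :: r) * weight_within l v r.
Proof.
move=> lt_mN v0 gt_v; rewrite all_cat /= => /and3P[le_l _ le_r].
rewrite /dd_weight !weight_within_cat -(cat1s N r) !weight_within_cat /= eqxx !mulr1 !mul1r.
rewrite !cats0.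
rewrite (@weight_within_right [::] v [:: N] r _ _ m) //=; last by rewrite lt_mN.
have := @weight_within_left l v [:: N] [::] r [::] m v0 gt_v isT _ le_r.
by rewrite /= !cats0 lt_mN => -> //; ring.
Qed.

Definition no_adjacent_holes a w := path (fun a b => ~~ ((a == N) && (b == N))) a w.

(* In the word of values below [v], the descents over [v] are the exits from holes. *)
Lemma descents_over_holes v a w :
    (v < N)%N -> (a == N) || (a < v)%N -> no_adjacent_holes a w ->
    all (fun c => (c < v)%N || (c == N)) w ->
  (descents_over v a w + (v < last a w) = count_mem N w + (v < a))%N.
Proof.
move=> lt_vN; elim: w a => //= b w IHw a le_a /andP[ab b_w] /andP[le_b le_w].
rewrite /descents_over /= -/(descents_over v b w).
have := IHw b _ b_w le_w; rewrite orbC le_b => /(_ isT).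
move: ab le_a le_b; case: (eqVneq b N) => /= [->|]; case: (eqVneq a N) => /= [->|]; lia.
Qed.

(** Each hole of [w] is entered once, from a letter below [v], since holes are never adjacent.
    Unlike for exits, neither end of the word needs a correction term. *)
Lemma ascents_over_holes v a w :
    (v < N)%N -> (a == N) || (a < v)%N -> no_adjacent_holes a w ->
    all (fun c => (c < v)%N || (c == N)) w ->
  ascents_over v a w = count_mem N w.
Proof.
move=> lt_vN; elim: w a => //= b w IHw a le_a /andP[ab b_w] /andP[le_b le_w].
rewrite /ascents_over /= -/(ascents_over v b w).
rewrite IHw //; last by rewrite orbC.
move: ab le_a le_b; case: (eqVneq b N) => /= [->|]; case: (eqVneq a N) => /= [->|]; lia.
Qed.

End Weight.

(** * Inserting values into words with holes *)

Section Insertion.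
Variable N : nat.

(** In this order the replacements make [v] a valley, a double descent, a double ascent and a peak:
    a hole kept beside [v] stands for a larger neighbour. *)
Definition insertions (v : nat) (c : seq nat) : seq (seq nat) :=
  [seq lr.1 ++ u ++ lr.2 | lr <- splits N c,
     u <- [:: [:: N; v; N]; [:: N; v]; [:: v; N]; [:: v]]].

Definition full (c : seq nat) : seq (seq nat) := if N \in c then [::] else [:: c].

Definition insertion_words k m c := leaves (fun m => insertions m.+1) full k m c.

Definition admissible m c :=
  no_adjacent_holes N 0 c && all (fun b => (b <= m) || (b == N)) c.

Lemma admissible_split m l r : m < N -> admissible m (l ++ N :: r) ->
  [/\ no_adjacent_holes N 0 l, last 0 l <= m, no_adjacent_holes N N r,
      all (fun b => (b <= m) || (b == N)) l & all (fun b => (b <= m) || (b == N)) r].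
Proof.
move=> lt_mN; rewrite /admissible /no_adjacent_holes cat_path all_cat /= eqxx andbT.
case/andP=> /and3P[l_ok lastN r_ok] /and3P[le_l _ le_r]; split=> //.
case/lastP: l lastN le_l {l_ok} => // l b; rewrite last_rcons all_rcons.
by move=> /negbTE-> /andP[]; rewrite orbF.
Qed.

Lemma admissible_insertions m c d :
  m.+1 < N -> admissible m c -> d \in insertions m.+1 c -> admissible m.+1 d.
Proof.
move=> lt_mN c_ok /allpairsPdep[[l r] [u [+ u4 ->]]].
rewrite mem_splits => /eqP Ec; rewrite {}Ec in c_ok.
have [l_ok le_last r_ok le_l le_r] := admissible_split (ltnW lt_mN) c_ok.
have r_ok' a : a != N -> no_adjacent_holes N a r.
  by case: r r_ok {le_r c_ok} => //= b r /andP[_ ->] /negbTE->.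
have neN : m.+1 != N by rewrite neq_ltn lt_mN.
have lastN : last 0 l != N by lia.
rewrite /admissible /no_adjacent_holes cat_path all_cat -!/(no_adjacent_holes N _ _) l_ok.
have leS w : all (fun b => (b <= m) || (b == N)) w -> all (fun b => (b <= m.+1) || (b == N)) w.
  by apply: sub_all => b; lia.
rewrite (leS _ le_l) /=; move: u4; rewrite !inE.
by case/or4P=> /eqP-> /=; rewrite ?eqxx ?leqnn ?(negbTE neN) ?(negbTE lastN) /= ?orbT
  ?(leS _ le_r) ?andbT /=; (exact: r_ok || exact: r_ok').
Qed.

Section Sum.
Local Open Scope ring_scope.
Variables (R : comNzRingType) (q x t : R).
Let W := dd_weight N q x t.

(** With [a] holes to the left and [b] to the right of the chosen one, [v] gets the exponent 2a + b
    = (h - 1) + a, whatever the shape of the replacement. *)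
Lemma sum_insertions k m c : (m.+1 < N)%N -> admissible m c ->
  \sum_(d <- insertions m.+1 c) W d * ddpoly q x t k (count_mem N d)
    = W c * ddpoly q x t k.+1 (count_mem N c).
Proof.
move=> lt_mN c_ok; set h := count_mem N c; set v := m.+1 in lt_mN *.
rewrite big_allpairs_dep -/h /=.
set S := (X in q ^+ _ * _ * X).
transitivity (\sum_(lr <- splits N c) (W c * q ^+ h.-1 * S) * q ^+ count_mem N lr.1); last first.
  by rewrite -big_distrr /= sum_splits; ring.
apply: eq_big_seq => -[l r]; rewrite mem_splits => /eqP Ec /=.
have [l_ok le_last r_ok le_l le_r] :
  [/\ no_adjacent_holes N 0 l, last 0 l <= m, no_adjacent_holes N N r,
      all (fun b => (b <= m) || (b == N)) l & all (fun b => (b <= m) || (b == N)) r]%N.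
  by apply: admissible_split; rewrite -?Ec // ltnW.
have neN : (v == N) = false by apply: ltn_eqF.
have Eh : h = (count_mem N l + count_mem N r).+1.
  by rewrite /h Ec count_cat /= eqxx; lia.
have ltS w : all (fun b => (b <= m) || (b == N))%N w -> all (fun b => (b < v) || (b == N))%N w.
  by [].
have vl : (v < last 0 l)%N = false by lia.
have dl : descents_over v 0 l = count_mem N l.
  have := @descents_over_holes N v 0 l lt_mN _ l_ok (ltS _ le_l).
  by rewrite orbT vl !addn0; apply.
have dlN : descents_over v 0 (l ++ [:: N]) = count_mem N l.
  rewrite /descents_over adjsum_cat -/(descents_over _ _ _) dl /=; lia.
have arN : ascents_over v N r = count_mem N r.
  by apply: ascents_over_holes => //; rewrite ?eqxx.
have ar : ascents_over v v r = count_mem N r.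
  by rewrite -arN; apply: ascents_over_above => //; apply: ltnW.
have aNr : ascents_over v v (N :: r) = count_mem N r.
  by rewrite /ascents_over /= ltnn -/(ascents_over v N r).
have rv : (head 0 r < v)%N.
  case: r r_ok le_r {Ec Eh arN ar aNr} => //= b r /andP[+ _] /andP[+ _].
  by rewrite eqxx /= => /negbTE->; rewrite orbF.
have lN : (v < last 0 (l ++ [:: N]))%N by rewrite last_cat.
have Nv : (N < v)%N = false by lia.
have fill u : u \in [:: [:: N; v; N]; [:: N; v]; [:: v; N]; [:: v]] ->
    W (l ++ u ++ r) = W c * weight_within N q x t l u r.
  move=> u4; rewrite /W Ec; apply: (@dd_weight_fill N R q x t l u r m).
  - by apply: ltnW.
  - by move: u4; rewrite !inE => /or4P[] /eqP->.
  - by move: u4; rewrite !inE => /or4P[] /eqP-> /=; rewrite ?leqnn ?(ltnW lt_mN).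
  - by rewrite all_cat /= le_l le_r eqxx orbT.
rewrite !big_cons big_nil !fill ?inE ?eqxx ?orbT // !count_cat /= neN !eqxx /=.
rewrite /letter_weight /= dl dlN ar aNr lN vl rv Nv Eh.
set a := count_mem N l; set b := count_mem N r.
rewrite (_ : (a + (1 + (0 + (1 + 0)) + b) = (a + b).+2)%N); last by lia.
rewrite (_ : (a + (1 + (0 + 0) + b) = (a + b).+1)%N); last by lia.
rewrite (_ : (a + (0 + 0 + b) = (a + b))%N); last by lia.
rewrite /S Eh /= mulSn mul1n !exprD expr0 !expr1.
by ring.
Qed.

Lemma sum_insertion_words k m c : (m + k < N)%N -> admissible m c ->
  \sum_(w <- insertion_words k m c) W w = W c * ddpoly q x t k (count_mem N c).
Proof.
elim: k m c => [|k IHk] m c lt_mk c_ok.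
  rewrite /insertion_words /= /full -has_pred1 has_count.
  by case: (count_mem N c) => [|h] /=; rewrite ?big_seq1 ?big_nil ?mulr1 ?mulr0.
rewrite -(sum_insertions _ _ c_ok); last by lia.
rewrite [insertion_words _ _ _]/= big_flatten big_map; apply: eq_big_seq => d d_c.
by apply: IHk; [lia | apply: admissible_insertions d_c => //; lia].
Qed.

End Sum.

End Insertion.

(** * Every permutation arises by insertions *)

Section Collapse.
Variable N : nat.
Hypothesis N_gt0 : 0 < N.

(** The default [0] of [head] cannot be mistaken for a hole, as [0 < N]. *)
Fixpoint merge_holes (w : seq nat) : seq nat :=
  if w is b :: w' then
    if (b == N) && (head 0 (merge_holes w') == N) then merge_holes w'
    else b :: merge_holes w'
  else [::].

Lemma merge_holes_letter a v b :
  v != N -> merge_holes (a ++ v :: b) = merge_holes a ++ v :: merge_holes b.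
Proof.
move=> vN; elim: a => [|c a IHa] /=; first by rewrite (negbTE vN).
rewrite IHa; case: (merge_holes a) => [|d s] /=; last by case: ifP.
by rewrite (negbTE vN) (ltn_eqF N_gt0) !andbF.
Qed.

(** The middle hole may absorb a hole ending the merged [a] and one beginning the merged [b]; the
    four possibilities correspond to the four insertions. *)
Lemma merge_holes_hole a b : exists l r, [/\ merge_holes (a ++ N :: b) = l ++ N :: r,
  merge_holes a = l \/ merge_holes a = l ++ [:: N]
  & merge_holes b = r \/ merge_holes b = N :: r].
Proof.
elim: a => [|c a [l [r [E a_l b_r]]]] /=.
  rewrite eqxx; case E: (merge_holes b) => [|c r] /=.
    by exists [::], [::]; rewrite ltn_eqF //; split=> //; left.
  case: eqVneq => [->|cN]; first by exists [::], r; split=> //; [left|right].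
  by exists [::], (c :: r); split=> //; left.
rewrite E; case: eqVneq => [->|cN] /=; last first.
  by exists (c :: l), r; split=> //; case: a_l => ->; [left|right].
case: l E a_l => [|d l] E a_l /=.
  rewrite eqxx; exists [::], r; split=> //; right.
  by case: a_l => -> /=; rewrite ?eqxx // ltn_eqF.
have -> : head 0 (merge_holes a) = d by case: a_l => ->.
case: eqVneq => _; first by exists (d :: l), r.
by exists (N :: d :: l), r; split=> //; case: a_l => ->; [left|right].
Qed.

Definition cap m (w : seq nat) := [seq if y <= m then y else N | y <- w].

Lemma capS m w : m.+1 \notin w -> cap m.+1 w = cap m w.
Proof.
move=> vw; apply/eq_in_map => y yw.
by rewrite leq_eqVlt ltnS; case: eqVneq yw vw => [->->|].
Qed.

Lemma cap_fill m a b : m.+1 \notin a -> m.+1 \notin b ->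
  cap m (a ++ m.+1 :: b) = cap m a ++ N :: cap m b
  /\ cap m.+1 (a ++ m.+1 :: b) = cap m a ++ m.+1 :: cap m b.
Proof.
by move=> va vb; rewrite -(capS va) -(capS vb) {1}capS // {1}capS // /cap !map_cat /= ltnn leqnn.
Qed.

Lemma cap_id m w : all (fun y => y <= m) w -> cap m w = w.
Proof. by rewrite /cap; elim: w => //= y w IHw /andP[-> /IHw->]. Qed.

(** The state of [w] once the values up to [m] are inserted: each maximal run of larger letters is
    one hole. *)
Definition collapse m (w : seq nat) := merge_holes (cap m w).

Lemma collapse_insertions m w : m.+1 < N -> m.+1 \in w -> uniq w ->
  collapse m.+1 w \in insertions N m.+1 (collapse m w).
Proof.
move=> lt_mN /splitPr[a b]; rewrite cat_uniq /= negb_or -andbA.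
case/and4P=> _ va _ /andP[vb _].
rewrite /collapse; have [-> ->] := cap_fill va vb.
rewrite merge_holes_letter; last by rewrite neq_ltn lt_mN.
have [l [r [-> a_l b_r]]] := merge_holes_hole (cap m a) (cap m b).
apply/allpairsPdep.
(* The new letter keeps a hole beside it on exactly those sides where the middle hole had absorbed
   one. *)
by case: a_l => ->; case: b_r => ->; exists (l, r);
  [exists [:: m.+1] | exists [:: m.+1; N] | exists [:: N; m.+1] | exists [:: N; m.+1; N]];
  rewrite mem_splits eqxx !inE eqxx ?orbT -?catA.
Qed.

Lemma collapse0 w : w != [::] -> all (leq 1) w -> collapse 0 w = [:: N].
Proof.
move=> w0 gt0; rewrite /collapse.
have -> : cap 0 w = nseq (size w) N.
  by elim: w gt0 {w0} => //= y w IHw /andP[y_gt0 /IHw->]; rewrite leqNgt y_gt0.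
case: w w0 {gt0} => //= _ w _; elim: {w}(size w) => [|k IHk] /=; first by rewrite eqxx ltn_eqF.
by move: IHk => /= ->; rewrite eqxx.
Qed.

Lemma collapse_id m w : m < N -> all (fun y => y <= m) w -> collapse m w = w.
Proof.
move=> lt_mN; move=> le_w; rewrite /collapse cap_id //.
elim: w le_w => //= y w IHw /andP[le_y /IHw->].
by rewrite ltn_eqF // (leq_ltn_trans le_y).
Qed.

Lemma mem_insertion_words n (s : 'S_n) : 0 < n -> n < N ->
  word s \in insertion_words N n 0 [:: N].
Proof.
move=> n_gt0 lt_nN; rewrite -(@collapse0 (word s)); first last.
- by apply/allP => y; rewrite mem_word => /andP[].
- by rewrite -size_eq0 size_word -lt0n.
apply: (mem_leaves (r := fun m => collapse m (word s))) => [i le_in|].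
  by apply: collapse_insertions; rewrite ?uniq_word ?mem_word //; lia.
have le_n : all (fun y => y <= n) (word s) by apply/allP => y; rewrite mem_word => /andP[].
rewrite collapse_id // /full ifF ?mem_seq1 //; apply/negP; rewrite mem_word; lia.
Qed.

End Collapse.

Section DescentSum.
Local Open Scope ring_scope.

Lemma dd_weight1 N (R : comNzRingType) w : dd_weight N (1 : R) 1 1 w = 1.
Proof.
suff weight1 l : weight_within N (1 : R) 1 1 l w [::] = 1 by apply: weight1.
by elim: w l => //= c w IHw l; rewrite IHw /letter_weight !expr1n !mulr1 if_same.
Qed.

(** At [q = x = t = 1] every word weighs 1, so the generating function evaluates to the length of
    the list. *)
Lemma size_insertion_words n : size (insertion_words n.+2 n.+1 0 [:: n.+2]) = n.+1`!.
Proof.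
have := @sum_insertion_words n.+2 int 1 1 1 n.+1 0 [:: n.+2] (ltnSn _).
rewrite dd_weight1 (eq_bigr (fun=> 1)) => [|w _]; last by rewrite dd_weight1.
rewrite big_const_seq count_predT iter_addr_0 mul1r.
rewrite (_ : count_mem _ _ = 1%N); last by rewrite /= eqxx.
rewrite ddpoly_unweighted bin0 muln1.
move=> /(_ _)/eqP; rewrite Num.Theory.eqr_nat => E; apply/eqP/E.
by rewrite /admissible /= eqxx.
Qed.

Lemma sum_dd_weight (R : comNzRingType) (q x t : R) n :
  \sum_(s : 'S_n.+1) dd_weight n.+2 q x t (word s) = ddpoly q x t n.+1 1.
Proof.
rewrite (@sum_word _ _ (insertion_words n.+2 n.+1 0 [:: n.+2])).
- rewrite sum_insertion_words //; last by rewrite /admissible /= eqxx.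
  rewrite (_ : count_mem _ _ = 1%N); last by rewrite /= eqxx.
  by rewrite /dd_weight /= eqxx !mul1r.
- exact: size_insertion_words.
- by move=> s; apply: mem_insertion_words.
Qed.

End DescentSum.

(** * Descent and pattern statistics read off the word *)

Lemma count_iota P m k : count P (iota m k) = \sum_(m <= i < m + k) P i.
Proof. by rewrite -sum1_count /index_iota addKn big_mkcond; apply: eq_bigr => i _; case: (P i). Qed.

Lemma sum_triangle (F : nat -> nat -> nat) n :
  \sum_(0 <= p < n) \sum_(0 <= i < p) F i p = \sum_(0 <= i < n) \sum_(i.+1 <= p < n) F i p.
Proof.
elim: n => [|n IHn]; first by rewrite !big_geq.
rewrite big_nat_recr // [RHS]big_nat_recr //= [X in _ = _ + X]big_geq // addn0 IHn -big_split.
by apply: eq_big_nat => i /andP[_ lt_in]; rewrite [RHS]big_nat_recr.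
Qed.

Lemma adjsum_nth f a w :
  adjsum f a w = \sum_(0 <= i < size w) f (nth 0 (a :: w) i) (nth 0 w i).
Proof.
elim: w a => [|b w IHw] a /=; first by rewrite big_geq.
by rewrite big_nat_recl //= IHw.
Qed.

Lemma last_take a w p : p <= size w -> last a (take p w) = nth 0 (a :: w) p.
Proof. by elim: w a p => [|b w IHw] a [|p] //= /IHw. Qed.

Lemma sig0 n (s : 'S_n) : sig s 0 = 0. Proof. by []. Qed.

Section WordStatistics.
Variables (n : nat) (s : 'S_n).

Lemma nth_cons_word p : nth 0 (0 :: word s) p = sig s p.
Proof. by case: p => // p; rewrite -nth_word. Qed.

Lemma des_word : \sum_(0 <= p < n) (sig s p.+1 < sig s p) = des s.
Proof.
rewrite /des count_iota; case: n s => [|m] s' /=; first by rewrite !big_geq.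
by rewrite add1n big_add1 big_nat_recl.
Qed.

Lemma dd_word :
  \sum_(0 <= p < n) ((sig s p.+1 < sig s p) && (sig s p.+2 < sig s p.+1)) = dd s.
Proof. by rewrite /dd count_iota add1n big_add1. Qed.

Lemma pat31_2_word :
  \sum_(0 <= p < n) descents_over (sig s p.+1) 0 (take p (word s)) = pat31_2 s.
Proof.
transitivity (\sum_(0 <= p < n) \sum_(0 <= i < p)
    ((sig s i.+1 < sig s p.+1) && (sig s p.+1 < sig s i))).
  apply: eq_big_nat => p /andP[_ lt_pn].
  rewrite /descents_over adjsum_nth size_takel ?size_word ?(ltnW lt_pn) //.
  apply: eq_big_nat => i /andP[_ lt_ip].
  rewrite -[0 :: take p _]/(take p.+1 (0 :: word s)) !nth_take ?nth_cons_word ?nth_word //.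
  exact: ltnW.
rewrite sum_triangle /pat31_2.
(* The row [i = 0] vanishes, since [sig s 0 = 0] starts no descent; removing it leads to the 1-based
   ranges. *)
have shift (f : nat -> nat -> nat) m : (forall p, f 0 p = 0) ->
    \sum_(0 <= i < m) \sum_(i.+1 <= p < m) f i p.+1
      = \sum_(1 <= i < m.+1) \sum_(i.+2 <= j < m.+1) f i j.
  move=> f0; case: m => [|m]; first by rewrite !big_geq.
  rewrite big_nat_recl // big1 ?add0n // [RHS]big_nat_recr //= [X in _ = _ + X]big_geq // addn0.
  by rewrite [RHS]big_add1; apply: eq_bigr => i _; rewrite [RHS]big_add1.
by apply: shift => p; rewrite sig0 andbF.
Qed.

Lemma pat2_13_word :
  \sum_(0 <= p < n) ascents_over (sig s p.+1) (sig s p.+1) (drop p.+1 (word s)) = pat2_13 s.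
Proof.
transitivity (\sum_(0 <= p < n) \sum_(p.+1 <= i < n)
    ((sig s i < sig s p.+1) && (sig s p.+1 < sig s i.+1))).
  apply: eq_big_nat => p /andP[_ lt_pn].
  rewrite /ascents_over adjsum_nth size_drop size_word -[in RHS](add0n p.+1) big_addn add0n.
  apply: eq_big_nat => i /andP[_ lt_i].
  rewrite (_ : sig s p.+1 :: _ = drop p (word s)).
  2: by rewrite (drop_nth 0 (n:=p)) ?size_word // nth_word.
  rewrite !nth_drop !nth_word.
  by rewrite addnS addSn (addnC i p).
pose f p i := nat_of_bool ((sig s i < sig s p.+1) && (sig s p.+1 < sig s i.+1)).
rewrite -(sum_triangle f) {}/f.
rewrite /pat2_13; have shift (f : nat -> nat) m :
    f 0 = 0 -> \sum_(0 <= i < m) f i = \sum_(1 <= i < m) f i.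
  by case: m => [|m] f0; [rewrite !big_geq | rewrite big_ltn // f0].
rewrite shift; last by rewrite big_geq.
apply: eq_big_nat => i /andP[i_gt0 _].
(* The extra last term is the pair starting at the letter that plays the 2, which is not below
   itself. *)
case: i i_gt0 => // i _; rewrite [RHS]big_add1 big_nat_recr //= ltnn andFb addn0.
by [].
Qed.

Local Open Scope ring_scope.

Lemma weight_within_nth N (R : comNzRingType) (q x t : R) l w r : N \notin w ->
  weight_within N q x t l w r =
    \prod_(0 <= p < size w) letter_weight q x t (l ++ take p w) (nth 0%N w p) (drop p.+1 w ++ r).
Proof.
elim: w l => [|c w IHw] l; first by rewrite big_geq.
rewrite inE negb_or eq_sym => /andP[/negbTE cN wN] /=.
rewrite cN big_nat_recl //= cats0 drop0 IHw //; congr (_ * _).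
by apply: eq_bigr => p _; rewrite -catA.
Qed.

Lemma dd_weight_word N (R : comNzRingType) (q x t : R) : (n < N)%N ->
  dd_weight N q x t (word s) = q ^+ (2 * pat31_2 s + pat2_13 s) * x ^+ des s * t ^+ dd s.
Proof.
move=> lt_nN; rewrite /dd_weight weight_within_nth; last by rewrite mem_word; lia.
rewrite -des_word -dd_word -pat31_2_word -pat2_13_word big_distrr -big_split /=.
rewrite -!prodrXr -!big_split size_word /=.
apply: eq_big_nat => p /andP[_ lt_pn]; rewrite /letter_weight cats0.
rewrite last_take ?size_word ?(ltnW lt_pn) // nth_cons_word nth_word.
by rewrite -nth0 nth_drop nth_word addn0.
Qed.

End WordStatistics.

Lemma sum_descents (R : comNzRingType) (q x t : R) n :
  (\sum_(s : 'S_n.+1) q ^+ (2 * pat31_2 s + pat2_13 s) * x ^+ des s * t ^+ dd s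
    = ddpoly q x t n.+1 1)%R.
Proof.
by rewrite -sum_dd_weight; apply: eq_bigr => s _; rewrite dd_weight_word.
Qed.

(** * Excedances and inversions *)

Fixpoint invw (w : seq nat) : nat :=
  if w is a :: w' then count (fun b => b < a) w' + invw w' else 0.

Definition excw (w : seq nat) : nat := \sum_(0 <= p < size w) (p.+1 < nth 0 w p).

(** With [i = p.+1], the value i + 1 occurs before position i + 1 exactly if it lies in the prefix
    of length i; in this form the statistic makes sense for scanned prefixes. *)
Definition scdaw (w : seq nat) : nat :=
  \sum_(0 <= p < size w) ((p.+1 < nth 0 w p) && (p.+2 \in take p.+1 w)).

Definition absent k (c : seq nat) : seq nat := [seq u <- iota 1 k | u \notin c].

Lemma invw_insert l a r :
  invw (l ++ a :: r) = invw (l ++ r) + count (fun b => a < b) l + count (fun b => b < a) r.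
Proof.
elim: l => [|b l IHl] /=; first by rewrite addn0 addnC.
by rewrite IHl !count_cat /=; lia.
Qed.

Lemma excw_rcons c a : excw (rcons c a) = excw c + ((size c).+1 < a).
Proof.
rewrite /excw size_rcons big_nat_recr //= nth_rcons ltnn eqxx; congr (_ + _).
by apply: eq_big_nat => p /andP[_ lt_p]; rewrite nth_rcons lt_p.
Qed.

Lemma scdaw_rcons c a :
  scdaw (rcons c a) = scdaw c + (((size c).+1 < a) && ((size c).+2 \in rcons c a)).
Proof.
rewrite /scdaw size_rcons big_nat_recr //= nth_rcons ltnn eqxx; congr (_ + _); last first.
  by rewrite take_oversize ?size_rcons.
by apply: eq_big_nat => p /andP[_ lt_p]; rewrite nth_rcons lt_p -cats1 takel_cat.
Qed.

Lemma sorted_absent k c : sorted ltn (absent k c).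
Proof. by apply: sorted_filter; [apply: ltn_trans | apply: iota_ltn_sorted]. Qed.

Lemma uniq_absent k c : uniq (absent k c).
Proof. exact: filter_uniq (iota_uniq _ _). Qed.

Lemma mem_absent k c u : (u \in absent k c) = (0 < u <= k) && (u \notin c).
Proof. by rewrite mem_filter mem_iota add1n ltnS andbC. Qed.

Lemma absent_rcons k c u : absent k (rcons c u) = [seq y <- absent k c | y != u].
Proof.
by rewrite /absent -filter_predI; apply: eq_filter => y; rewrite /= mem_rcons inE negb_or.
Qed.

Lemma absentS k c :
  absent k.+1 c = absent k c ++ (if k.+1 \in c then [::] else [:: k.+1]).
Proof.
have -> : absent k.+1 c = [seq u <- iota 1 k ++ [:: k.+1] | u \notin c].
  by rewrite -[[:: k.+1]]/(iota (1 + k) 1) -iotaD addn1.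
by rewrite filter_cat /=; case: (_ \in c).
Qed.

(** * Effect of single placements on the statistics *)

Section Step.
Variables (N m : nat).
Hypothesis lt_mN : m.+2 < N.

Let fits (b : nat) := (b <= m.+1) || (b == N).

Lemma count_hole_above w : all fits w -> count (fun b => m.+2 < b) w = count_mem N w.
Proof. by move=> ok; apply: eq_in_count => b /(allP ok); rewrite /fits /=; lia. Qed.

Lemma count_below_hole w : all fits w ->
  count (fun b => b < N) w = count (fun b => b < m.+2) w.
Proof. by move=> ok; apply: eq_in_count => b /(allP ok); rewrite /fits /=; lia. Qed.

Lemma fits_absent k c : k <= m.+1 -> all fits (absent k c).
Proof. by move=> le_k; apply/allP => b; rewrite mem_absent /fits; lia. Qed.

Lemma absent_hole c k : k <= m.+1 -> absent k (rcons c N) = absent k c.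
Proof.
move=> le_k; rewrite absent_rcons; apply/all_filterP/allP => b.
by rewrite mem_absent; lia.
Qed.

(** The hole exceeds all absent values, which follow it, and no earlier letter exceeds the hole. *)
Lemma invw_open_position c : all fits c ->
  invw (rcons c N ++ absent m.+1 c) = invw (c ++ absent m.+1 c) + size (absent m.+1 c).
Proof.
move=> ok; rewrite cat_rcons invw_insert; rewrite [X in _ + X + _](_ : _ = 0); last first.
  by apply/eqP; rewrite -leqn0 leqNgt -has_count; apply/hasPn => b /(allP ok); rewrite /fits; lia.
rewrite addn0; congr (_ + _); apply/eqP; rewrite -all_count; apply/allP => b.
by rewrite mem_absent /=; lia.
Qed.

(** The absent values increase, so moving [u] in front of them creates inversions exactly with the
    smaller ones. *)
Lemma invw_close_position c u k : u \in absent k c ->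
  invw (rcons c u ++ absent k (rcons c u)) = invw (c ++ absent k c) + index u (absent k c).
Proof.
rewrite absent_rcons; have := sorted_absent k c; have := uniq_absent k c.
move=> + + u_abs; case/splitPr: (absent k c) / u_abs => o1 o2.
rewrite cat_uniq /= negb_or => /and4P[_ /andP[u1 _] u2 _].
rewrite (sorted_pairwise ltn_trans) pairwise_cat /= allrel_consr.
case/and4P=> /andP[lt1 _] _ lt2 _.
rewrite index_cat (negbTE u1) /= eqxx addn0 filter_cat /= eqxx /=.
have neq s : u \notin s -> [seq y <- s | y != u] = s.
  by move=> us; apply/all_filterP/allP => y; apply: contraTneq => ->.
rewrite !neq // cat_rcons catA !invw_insert -catA !count_cat.
have -> : count (fun b => b < u) o1 = size o1 by apply/eqP; rewrite -all_count.
have none P s : all (predC P) s -> count P s = 0.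
  by move=> sP; apply/eqP; rewrite -leqn0 leqNgt -has_count -all_predC.
rewrite [count (fun b => b < u) o2]none; last by apply: sub_all lt2 => b /=; lia.
rewrite [count (fun b => u < b) o1]none; last by apply: sub_all lt1 => b /=; lia.
by rewrite !addn0.
Qed.

Lemma invw_open_value d o : all fits d -> all fits o -> count_mem N o = 0 ->
  invw (d ++ rcons o m.+2) = invw (d ++ o) + count_mem N d.
Proof.
move=> d_ok o_ok oN; rewrite -cats1 catA invw_insert cats0 addn0.
by rewrite count_hole_above ?all_cat ?d_ok // count_cat oN addn0.
Qed.

(** A hole and [m.+2] exceed the same letters to their right, while the holes to the left now exceed
    the filled letter. *)
Lemma invw_close_value l r o : all fits (l ++ N :: r) -> all fits o ->
  invw ((l ++ m.+2 :: r) ++ o) = invw ((l ++ N :: r) ++ o) + count_mem N l.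
Proof.
rewrite all_cat /= => /and3P[l_ok _ r_ok] o_ok; rewrite -!catA !cat_cons !invw_insert.
rewrite count_below_hole ?all_cat ?r_ok // count_hole_above //.
rewrite [count _ l in RHS](_ : _ = 0); first by rewrite addn0 addnAC.
by apply/eqP; rewrite -leqn0 leqNgt -has_count; apply/hasPn => b /(allP l_ok); rewrite /fits; lia.
Qed.

Lemma nth_fill l r p :
  nth 0 (l ++ m.+2 :: r) p = if p == size l then m.+2 else nth 0 (l ++ N :: r) p.
Proof.
rewrite !nth_cat; case: ltngtP => // [lt_lp | ->]; last by rewrite subnn.
by case: (p - size l) (subn_gt0 (size l) p) => [|j]; rewrite lt_lp.
Qed.

Lemma nth_hole l r : nth 0 (l ++ N :: r) (size l) = N.
Proof. by rewrite nth_cat ltnn subnn. Qed.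

(** The hole sits at a position at most [m.+1], so [m.+2] is an excedance there just as [N] was. *)
Lemma excw_fill l r : size (l ++ N :: r) = m.+1 ->
  excw (l ++ m.+2 :: r) = excw (l ++ N :: r).
Proof.
move=> sz; rewrite /excw size_cat /= -[size l + _](size_cat l (N :: r)) sz.
apply: eq_big_nat => p /andP[_ lt_pm]; rewrite nth_fill.
by case: eqVneq => // ->; rewrite nth_hole; move: sz; rewrite size_cat /=; lia.
Qed.

(** Within the prefix only index [m.+1] asks for the value [m.+2]; it becomes counted if the last
    letter exceeds [m.+1]. *)
Lemma scdaw_fill l r : size (l ++ N :: r) = m.+1 -> all fits (l ++ N :: r) ->
  scdaw (l ++ m.+2 :: r) = scdaw (l ++ N :: r) + (m.+1 < last 0 (l ++ N :: r)).
Proof.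
move=> sz ok; have szv : size (l ++ m.+2 :: r) = m.+1 by rewrite -sz !size_cat.
have le_l : size l <= m by move: sz; rewrite size_cat /=; lia.
rewrite /scdaw sz szv !big_nat_recr //= -addnA; congr (_ + _).
  apply: eq_big_nat => p /andP[_ lt_pm]; congr (nat_of_bool (_ && _)).
    by rewrite nth_fill; case: eqVneq => // ->; rewrite nth_hole; lia.
  rewrite !take_cat; case: ifP => // _; rewrite !mem_cat; congr (_ || _).
  by case: (p.+1 - size l) => //= j; rewrite !inE !ltn_eqF //; lia.
rewrite !take_oversize ?sz ?szv // mem_cat inE eqxx orbT andbT.
rewrite [_ \in _](_ : _ = false) ?andbF; last first.
  by apply/negP => /(allP ok); rewrite /fits; lia.
rewrite add0n nth_fill (last_nth 0) sz /=.
by case: eqVneq => // E; rewrite E nth_hole -E; lia.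
Qed.

End Step.

(** * Scanning positions and values together *)

Section Scan.
Variable N : nat.

(** A value exceeding its position is never placed at once: the position stays open until that value
    is processed by [fillings]. *)
Definition extensions (m : nat) (c : seq nat) : seq (seq nat) :=
  [seq rcons c a | a <- N :: absent m.+1 c].

Definition fillings (m : nat) (d : seq nat) : seq (seq nat) :=
  d :: [seq lr.1 ++ m.+2 :: lr.2 | lr <- splits N d].

Definition scan_step m c : seq (seq nat) := [seq e | d <- extensions m c, e <- fillings m d].

Definition scan_end (c : seq nat) : seq (seq nat) :=
  if N \in c then [::] else [:: c ++ absent (size c).+1 c].

Definition scan_words k m c := leaves scan_step scan_end k m c.

(* In a scanned prefix of length [m] the values up to [m.+1] are processed, so
   there is one more unassigned value than there are holes (open positions). *)
Definition scannable m c :=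
  [/\ size c = m, all (fun b => (b <= m.+1) || (b == N)) c,
      size (absent m.+1 c) = (count_mem N c).+1
    & excw c <= invw (c ++ absent m.+1 c)].

Section Sum.
Local Open Scope ring_scope.
Variables (R : comNzRingType) (q x t : R).

(* The unassigned values [o] all belong to later positions; appending them in increasing
   order counts exactly the inversions that are already determined. *)
Definition inv_weight w o : R :=
  q ^+ (invw (w ++ o) - excw w) * x ^+ excw w * t ^+ scdaw w.

(** Leaving [m.+2] unassigned costs an inversion with every hole, filling a hole one with every hole
    to its left. The bound of [excw] by [invw] makes the truncated difference in the exponent
    additive. *)
Lemma sum_fillings m d (f : nat -> R) : (m.+2 < N)%N -> size d = m.+1 ->
    all (fun b => (b <= m.+1) || (b == N))%N d ->
    (excw d <= invw (d ++ absent m.+1 d))%N ->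
    size (absent m.+1 d) = count_mem N d ->
  [/\ \sum_(e <- fillings m d) inv_weight e (absent m.+2 e) * f (count_mem N e).+1
        = inv_weight d (absent m.+1 d) * (q ^+ count_mem N d * f (count_mem N d).+1
            + t ^+ (m.+1 < last 0 d)%N * qint q (count_mem N d) * f (count_mem N d))
    & {in fillings m d, forall e, scannable m.+1 e}].
Proof.
move=> lt_mN sz ok le_ei sz_abs.
have vd : m.+2 \notin d by apply/negP => /(allP ok); lia.
have abs_ok : all (fun b => (b <= m.+1) || (b == N))%N (absent m.+1 d) by apply: fits_absent.
have absN : count_mem N (absent m.+1 d) = 0%N.
  by apply/count_memPn; rewrite mem_absent; lia.
have absd : absent m.+2 d = rcons (absent m.+1 d) m.+2.
  by rewrite absentS (negbTE vd) cats1.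
have inv_d := invw_open_value lt_mN ok abs_ok absN.
have fill l r : d = l ++ N :: r ->
    [/\ absent m.+2 (l ++ m.+2 :: r) = absent m.+1 d,
        invw ((l ++ m.+2 :: r) ++ absent m.+1 d) = (invw (d ++ absent m.+1 d) + count_mem N l)%N,
        excw (l ++ m.+2 :: r) = excw d,
        scdaw (l ++ m.+2 :: r) = (scdaw d + (m.+1 < last 0 d))%N
      & (count_mem N (l ++ m.+2 :: r)).+1 = count_mem N d].
  move=> Ed; have [szl okl] : size (l ++ N :: r) = m.+1 /\
      all (fun b => (b <= m.+1) || (b == N))%N (l ++ N :: r) by rewrite -Ed.
  split; last by rewrite Ed !count_cat /= eqxx (ltn_eqF lt_mN); lia.
  - rewrite absentS mem_cat inE eqxx orbT cats0; apply: eq_in_filter => u.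
    rewrite mem_iota Ed !mem_cat !inE !negb_or.
    by case: eqVneq => [->|]; case: eqVneq => [->|]; lia.
  - by rewrite (invw_close_value lt_mN) -?Ed.
  - by rewrite Ed (excw_fill lt_mN).
  - by rewrite Ed (scdaw_fill lt_mN).
split; last first.
  move=> e; rewrite inE => /predU1P[->|/mapP[[l r]]].
    split; first exact: sz.
    - by apply: sub_all ok => b; lia.
    - by rewrite absd size_rcons sz_abs.
    - by rewrite absd inv_d; lia.
  rewrite mem_splits => /eqP Ed -> /=; have [E0 E1 E2 _ E3] := fill l r Ed.
  split; rewrite ?E0 ?E3 //; last by rewrite E1 E2; lia.
  - by rewrite -sz Ed !size_cat.
  - rewrite all_cat /= leqnn /=.
    by have := ok; rewrite Ed all_cat /= => /and3P[okl _ okr]; apply/andP; split;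
      [apply: sub_all okl | apply: sub_all okr] => b; lia.
rewrite big_cons absd big_map mulrDr; congr (_ + _).
  by rewrite /inv_weight inv_d -addnBAC // exprD; ring.
rewrite -sum_splits big_distrr big_distrl big_distrr /=.
apply: eq_big_seq => -[l r]; rewrite mem_splits => /eqP Ed /=.
have [E0 E1 E2 E3 E4] := fill l r Ed.
by rewrite /inv_weight E0 E1 E2 E3 E4 -addnBAC // !exprD; ring.
Qed.

(** Opening the position costs h + 1 inversions, less one for the excedance, hence x q^h; closing it
    gives [h+1]_q. Combined with the two outcomes for the value, this yields the up step, two level
    steps and the down step. *)
Lemma sum_scan_step m k c : (m.+2 < N)%N -> scannable m c ->
  [/\ \sum_(e <- scan_step m c) inv_weight e (absent m.+2 e) * excpoly q x t k (count_mem N e).+1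
        = inv_weight c (absent m.+1 c) * excpoly q x t k.+1 (count_mem N c).+1
    & {in scan_step m c, forall e, scannable m.+1 e}].
Proof.
move=> lt_mN [sz ok sz_abs le_ei]; set h := count_mem N c in sz_abs *.
set f := excpoly q x t k.
have neN u : u \in absent m.+1 c -> (u == N) = false by rewrite mem_absent; lia.
have okr a : (a <= m.+1)%N || (a == N) -> all (fun b => (b <= m.+1) || (b == N))%N (rcons c a).
  by move=> ok_a; rewrite all_rcons ok_a.
have absN : absent m.+1 (rcons c N) = absent m.+1 c by apply: (absent_hole lt_mN).
have invN := invw_open_position lt_mN ok.
have excN : excw (rcons c N) = (excw c).+1 by rewrite excw_rcons sz; lia.
have cntN : count_mem N (rcons c N) = h.+1.
  by rewrite -cats1 count_cat /= eqxx addn0 addn1.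
have scdaN : scdaw (rcons c N) = scdaw c.
  rewrite scdaw_rcons sz [_ \in _](_ : _ = false) ?andbF ?addn0 //.
  by apply/negP => /(allP (okr N _)); lia.
have [||||sumN scanN] := @sum_fillings m (rcons c N) f lt_mN _ (okr N _).
- by rewrite size_rcons sz.
- by rewrite eqxx orbT.
- by rewrite absN invN excN sz_abs; lia.
- by rewrite absN cntN.
have close u : u \in absent m.+1 c ->
  [/\ \sum_(e <- fillings m (rcons c u)) inv_weight e (absent m.+2 e) * f (count_mem N e).+1
        = inv_weight c (absent m.+1 c) * q ^+ index u (absent m.+1 c)
            * (q ^+ h * f h.+1 + qint q h * f h)
    & {in fillings m (rcons c u), forall e, scannable m.+1 e}].
  move=> u_abs; have := u_abs; rewrite mem_absent => /andP[/andP[_ le_u] uc].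
  have exc_u : excw (rcons c u) = excw c by rewrite excw_rcons sz ltnNge le_u addn0.
  have scda_u : scdaw (rcons c u) = scdaw c by rewrite scdaw_rcons sz ltnNge le_u addn0.
  have cnt_u : count_mem N (rcons c u) = h.
    by rewrite -cats1 count_cat /= neN // !addn0.
  have inv_u := invw_close_position lt_mN u_abs.
  have abs_u : absent m.+1 (rcons c u) = rem u (absent m.+1 c).
    by rewrite absent_rcons rem_filter // uniq_absent.
  have [||||sum_u scan_u] := @sum_fillings m (rcons c u) f lt_mN _ (okr u _).
  - by rewrite size_rcons sz.
  - by rewrite le_u.
  - by rewrite inv_u exc_u; lia.
  - by rewrite abs_u size_rem // sz_abs cnt_u.
  split=> //; rewrite sum_u cnt_u last_rcons ltnNge le_u mul1r; congr (_ * _).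
  by rewrite /inv_weight inv_u exc_u scda_u -addnBAC // exprD; ring.
split; last first.
  move=> e /allpairsPdep[d [e' [/mapP[a + ->] e'_d ->]]].
  by rewrite inE => /predU1P[Ea|/close[_ scan_a]]; [apply: scanN; rewrite -Ea | apply: scan_a].
rewrite -[excpoly _ _ _ k.+1 _]/(x * q ^+ (2 * h.+1).-1 * f h.+2
  + (1 + x * t) * (q ^+ h * qint q h.+1) * f h.+1 + qint q h.+1 * qint q h * f h).
rewrite (_ : (2 * h.+1).-1 = h + h.+1)%N; last by lia.
rewrite big_allpairs_dep big_map big_cons sumN cntN last_rcons.
rewrite (eq_big_seq (fun u => inv_weight c (absent m.+1 c) * q ^+ index u (absent m.+1 c)
            * (q ^+ h * f h.+1 + qint q h * f h))); last by move=> u /close[].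
rewrite -big_distrl -big_distrr /= sum_index ?uniq_absent // sz_abs.
rewrite /inv_weight absN invN excN scdaN sz_abs (ltnW lt_mN).
rewrite (_ : (_ + h.+1 - _) = (invw (c ++ absent m.+1 c) - excw c) + h)%N; last by lia.
by rewrite !exprD !exprS expr0; ring.
Qed.

Lemma sum_scan_words k m c : (m + k < N.-1)%N -> scannable m c ->
  \sum_(w <- scan_words k m c) inv_weight w [::]
    = inv_weight c (absent m.+1 c) * excpoly q x t k (count_mem N c).+1.
Proof.
elim: k m c => [|k IHk] m c lt_mk c_ok.
  have [sz ok sz_abs _] := c_ok; rewrite /scan_words /= /scan_end -has_pred1 has_count eqSS.
  (* Without holes exactly one value is missing; being at most [m.+1], it creates no excedance in
     the last position. *)
  case E: (count_mem N c) sz_abs => [|h] /=; last by rewrite big_nil mulr0.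
  rewrite sz big_seq1 mulr1; case: (absent m.+1 c) (mem_absent m.+1 c) => [|u [|//]] // mem_u _.
  have le_u : (u <= m.+1)%N by have := mem_u u; rewrite inE eqxx; lia.
  rewrite /inv_weight cats0 cats1 excw_rcons scdaw_rcons sz.
  by rewrite [(_ < u)%N]ltnNge le_u !addn0.
have [|sum_step scan_step_ok] := @sum_scan_step m k c _ c_ok; first by lia.
rewrite -sum_step -[scan_words _ _ _]/(flatten [seq scan_words k m.+1 d | d <- scan_step m c]).
rewrite big_flatten big_map; apply: eq_big_seq => d d_c.
by apply: IHk; [lia | apply: scan_step_ok].
Qed.

End Sum.

End Scan.

Lemma mem_scan_words n (s : 'S_n.+1) : word s \in scan_words n.+2 n 0 [::].
Proof.
set N := n.+2; set w := word s.
have mem_w := mem_word s; have uniq_w := uniq_word s; have size_w := size_word s.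
rewrite -/w in mem_w uniq_w size_w.
have w_eq m : m <= n -> take m.+1 w = rcons (take m w) (nth 0 w m).
  by move=> le_mn; apply: take_nth; rewrite size_w.
have w_fresh m : m <= n -> nth 0 w m \notin take m w.
  by move=> /w_eq E; have := take_uniq m.+1 uniq_w; rewrite E rcons_uniq => /andP[].
have take_le m y : y \in take m w -> 0 < y <= n.+1.
  by move=> /mem_take; rewrite mem_w.
rewrite -[[::]]/(cap N 1 (take 0 w)).
(* The branch to [w] passes through its prefixes of length [m] with the values above [m.+1] turned
   into holes. *)
apply: (mem_leaves (r := fun m => cap N m.+1 (take m w))) => [m lt_mn|]; last first.
  have le_w : all (fun y => y <= n.+1) (take n w).
    by apply/allP => y /take_le/andP[].
  rewrite add0n cap_id // /scan_end ifF; last by apply/negP => /take_le; rewrite /N; lia.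
  have E : take n.+1 w = w by rewrite take_oversize ?size_w.
  rewrite w_eq // in E; rewrite size_take size_w ltnSn.
  have -> : absent n.+1 (take n w) = [:: nth 0 w n].
    apply/perm_small_eq => //; apply: uniq_perm; rewrite ?uniq_absent // => u.
    rewrite mem_absent -mem_w -{1}E mem_rcons !inE andb_orl andbN orbF.
    by case: eqVneq => // ->; rewrite w_fresh.
  by rewrite cats1 E mem_seq1.
have le_mn : m <= n by lia.
have fresh := w_fresh m le_mn; have size_take_m : size (take m w) = m.
  by rewrite size_takel // size_w; lia.
apply/allpairsPdep; exists (cap N m.+1 (take m.+1 w)), (cap N m.+2 (take m.+1 w)); split=> //.
  apply/mapP; exists (if nth 0 w m <= m.+1 then nth 0 w m else N).
    case: ifP => le_m; rewrite inE ?eqxx // mem_absent le_m orbC.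
    rewrite (_ : 0 < nth 0 w m) /=; last first.
      by have : nth 0 w m \in w by [apply: mem_nth; rewrite size_w]; rewrite mem_w; lia.
    apply/orP; left; apply/mapP => -[y y_w Ey].
    move: Ey; case: ifP => _ Ey; last by move: le_m; rewrite Ey /N; lia.
    by move: fresh; rewrite Ey y_w.
  by rewrite w_eq // /cap map_rcons.
rewrite /fillings inE; have [v_w|v_w] := boolP (m.+2 \in take m.+1 w); last first.
  by rewrite capS // eqxx.
apply/orP; right; have := take_uniq m.+1 uniq_w; case/splitPr: v_w => a b.
rewrite cat_uniq /= negb_or => /and4P[_ /andP[va _] vb _].
have [-> ->] := cap_fill N va vb.
by apply/mapP; exists (cap N m.+1 a, cap N m.+1 b); rewrite ?mem_splits.
Qed.

Section ScanSum.
Local Open Scope ring_scope.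

Lemma scannable_nil N : scannable N 0 [::].
Proof. by split=> //; rewrite /excw big_geq. Qed.

Lemma inv_weight_nil (R : comNzRingType) (q x t : R) o : inv_weight q x t [::] [:: o] = 1.
Proof. by rewrite /inv_weight /excw /scdaw !big_geq // !expr0 !mulr1. Qed.

Lemma size_scan_words n : size (scan_words n.+2 n 0 [::]) = n.+1`!.
Proof.
have := sum_scan_words (1 : int) 1 1 (_ : 0 + n < n.+2.-1)%N (scannable_nil n.+2).
rewrite add0n ltnSn inv_weight_nil mul1r excpoly1 ddpoly_unweighted bin0 muln1.
rewrite (eq_bigr (fun=> 1)) => [|w _]; last by rewrite /inv_weight !expr1n !mulr1.
rewrite big_const_seq count_predT iter_addr_0 => /(_ isT)/eqP.
by rewrite Num.Theory.eqr_nat => /eqP.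
Qed.

Lemma sum_inv_weight (R : comNzRingType) (q x t : R) n :
  \sum_(s : 'S_n.+1) inv_weight q x t (word s) [::] = ddpoly q x t n.+1 1.
Proof.
rewrite (sum_word (fun w => inv_weight q x t w [::]) (size_scan_words n) (@mem_scan_words n)).
rewrite (sum_scan_words _ _ _ _ (scannable_nil n.+2)) ?add0n //.
by rewrite inv_weight_nil mul1r excpoly1.
Qed.

End ScanSum.

(** * Excedance statistics read off the word, and the star companion *)

Lemma invw_nth w : invw w =
  \sum_(0 <= i < size w) \sum_(i.+1 <= j < size w) (nth 0 w j < nth 0 w i).
Proof.
elim: w => [|a w IHw]; first by rewrite big_geq.
rewrite /= big_nat_recl // big_add1 /= IHw; congr (_ + _).
  rewrite -sum1_count big_mkcond (big_nth 0) /=.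
  by apply: eq_bigr => i _; case: (_ < _).
by apply: eq_bigr => i _; rewrite [RHS]big_add1.
Qed.

Lemma sigK n (s : 'S_n) i : 0 < i <= n -> siginv s (sig s i) = i.
Proof.
case: i => // i lt_in; rewrite (sig_ord s (Ordinal lt_in)) /siginv sig_ord permK.
by [].
Qed.

Lemma siginvK n (s : 'S_n) i : 0 < i <= n -> sig s (siginv s i) = i.
Proof. by move=> lt_in; have := sigK s^-1 lt_in; rewrite /siginv invgK. Qed.

Lemma sig_range n (s : 'S_n) i : 0 < i <= n -> 0 < sig s i <= n.
Proof. by case: i => // i lt_in; rewrite (sig_ord s (Ordinal lt_in)) /= ltn_ord. Qed.

Lemma index_word n (s : 'S_n) y : 0 < y <= n -> (index y (word s)).+1 = siginv s y.
Proof.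
move=> y_n; have := sig_range s^-1 y_n; rewrite -/(siginv s y) => j_n.
have Ej : siginv s y = (siginv s y).-1.+1 by lia.
rewrite -{1}(siginvK s y_n) Ej -nth_word index_uniq ?uniq_word //.
by rewrite size_word; lia.
Qed.

Section ExcedanceStatistics.
Variables (n : nat) (s : 'S_n).

Lemma inv_word : invw (word s) = Defs.inv s.
Proof.
rewrite invw_nth size_word /Defs.inv big_add1; apply: eq_bigr => i _.
by rewrite [RHS]big_add1; apply: eq_bigr => j _; rewrite !nth_word.
Qed.

Lemma exc_word : excw (word s) = exc s.
Proof.
rewrite /exc count_iota add1n big_add1 /excw size_word.
by apply: eq_bigr => p _; rewrite nth_word.
Qed.

Lemma scda_word : scdaw (word s) = scda s.
Proof.
rewrite /scda count_iota add1n big_add1 /scdaw size_word.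
have [n0|n_gt0] := posnP n; first by rewrite !big_geq //=; lia.
have -> : \sum_(0 <= p < n)
      ((p.+1 < nth 0 (word s) p) && (p.+2 \in take p.+1 (word s))) =
    \sum_(0 <= p < n.-1) ((p.+1 < nth 0 (word s) p) && (p.+2 \in take p.+1 (word s))).
  have sum_last (f : nat -> nat) m : 0 < m -> f m.-1 = 0 ->
      \sum_(0 <= p < m) f p = \sum_(0 <= p < m.-1) f p.
    by case: m => // m _ fm; rewrite big_nat_recr //= fm addn0.
  (* The last position carries no excedance, as [sig s n <= n]. *)
  apply: sum_last => //; rewrite prednK // nth_word prednK //.
  by have := @sig_range n s n; rewrite n_gt0 leqnn => /(_ isT); lia.
apply: eq_big_nat => p /andP[_ lt_p]; rewrite nth_word; congr (nat_of_bool (_ && _)).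
have p_n : 0 < p.+2 <= n by lia.
by rewrite in_take ?mem_word // -index_word.
Qed.

(** As [star s] is injective on 0, ..., n, the search can only stop at the position of the value
    [i.+1]; position 0, of star value [n], is excluded by [i < n]. *)
Lemma starinv_siginv i : 0 < i < n -> starinv s i = siginv s i.+1.
Proof.
move=> i_n; have Si_n : 0 < i.+1 <= n by lia.
have j_n := sig_range s^-1 Si_n; rewrite -/(siginv s i.+1) in j_n.
have -> : starinv s i = nth 0 (iota 0 n.+1) (index i [seq star s p | p <- iota 0 n.+1]).
  by rewrite /starinv /index find_map.
have star0 : star s 0 = n by [].
have starE j : 0 < j -> star s j = (sig s j).-1 by case: j.
have uniq_star : uniq [seq star s p | p <- iota 0 n.+1].
  rewrite map_inj_in_uniq ?iota_uniq // => a b; rewrite !mem_iota !add0n !ltnS /= => le_an le_bn.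
  have range c : 0 < c <= n -> 0 < sig s c <= n := @sig_range n s c.
  have [->|a_gt0] := posnP a; have [->|b_gt0] := posnP b => //.
  - by rewrite star0 starE //; have := range b; rewrite b_gt0 le_bn => /(_ isT); lia.
  - by rewrite star0 starE //; have := range a; rewrite a_gt0 le_an => /(_ isT); lia.
  rewrite !starE // => E; have := range a; have := range b; rewrite a_gt0 b_gt0 le_an le_bn.
  move=> /(_ isT) rb /(_ isT) ra; have {}E : sig s a = sig s b by lia.
  by rewrite -(@sigK n s a) ?a_gt0 // E sigK ?b_gt0.
have Ei : nth 0 [seq star s p | p <- iota 0 n.+1] (siginv s i.+1) = i.
  rewrite (nth_map 0) ?size_iota ?nth_iota ?add0n; [|lia|lia].
  by rewrite starE ?siginvK //; lia.
rewrite -{1}Ei index_uniq ?size_map ?size_iota //; last by lia.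
by rewrite nth_iota //; lia.
Qed.

(* On positions below n, [starinv] is [siginv] shifted by one, so an index counted
   by [scda] is a star double ascent when [sig s i <> i.+1], a star fixed point otherwise. *)
Lemma star_scda : cdastar s + fixstar s = scda s.
Proof.
rewrite /cdastar /fixstar /scda !count_iota -big_split /=.
apply: eq_big_nat => i i_n; have {}i_n : 0 < i < n by lia.
rewrite starinv_siginv // /star ifF; last by lia.
have r_n : 0 < sig s i <= n by apply: sig_range; lia.
have Si_n : 0 < i.+1 <= n by lia.
have fix_i : (sig s i == i.+1) = (siginv s i.+1 == i).
  apply/eqP/eqP => [<-|Ei]; first by apply: sigK; lia.
  by rewrite -{1}Ei siginvK.
by move: fix_i; case: (eqVneq (siginv s i.+1) i) => [->|]; lia.
Qed.

End ExcedanceStatistics.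

Local Open Scope ring_scope.

Lemma sum_excedances (R : comNzRingType) (q x t : R) n :
  \sum_(s : 'S_n.+1) q ^+ (Defs.inv s - exc s) * x ^+ exc s * t ^+ scda s = ddpoly q x t n.+1 1.
Proof.
rewrite -sum_inv_weight; apply: eq_bigr => s _.
by rewrite /inv_weight cats0 inv_word exc_word scda_word.
Qed.

(** Here q is the inner variable, x the outer one and t = 0; since [0 ^+ 0 = 1], exactly the terms
    with [c s = 0] survive, and the coefficient at [k] selects [b s = k]. *)
Lemma coef_refined_sum (T : finType) (a b c : T -> nat) k :
  \sum_(s : T | (b s == k) && (c s == 0)%N) 'X^(a s) =
    (\sum_(s : T) ('X%:P : {poly {poly int}}) ^+ a s * 'X ^+ b s * 0 ^+ c s)`_k.
Proof.
rewrite coef_sum big_mkcond; apply: eq_bigr => s _.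
rewrite -polyC_exp expr0n; case: (c s == 0%N); last by rewrite mulr0 andbF coef0.
by rewrite mulr1 coefCM coefXn andbT eq_sym; case: (k == b s); rewrite ?mulr1 ?mulr0.
Qed.
Close Scope ring_scope.

Theorem theorem2p10 (n k : nat) (hk : (2 * k + 1 <= n)%N) :
  gammaDD n k = gammaDEstar n k /\ gammaDEstar n k = gammaSDE n k.
Proof.
have E : gammaDEstar n k = gammaSDE n k.
  by apply: eq_bigl => s; rewrite star_scda.
rewrite E; split=> //; rewrite /gammaDD /gammaSDE !coef_refined_sum.
by case: n hk {E} => [|n] hk; [lia | rewrite sum_descents sum_excedances].
Qed.
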